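(* Let $(X,g)$ be a compact minimal system and let $h\in\tau[g]$. Then there are nonnegative integers $o^+(h)$ and $o^-(h)$ such that every $g$-orbit contains exactly $o^+(h)$ positive $h$-orbits and exactly $o^-(h)$ negative $h$-orbits (with respect to $g$). Moreover, the index map $I:\tau[g]\to\mathbb{Z}$ is given by \[ I(h)=o^+(h)-o^-(h). \]
   Context: A homeomorphism $g$ of a Hausdorff space $X$ is minimal if $X\neq\emptyset$ and the only proper closed subset $K\subsetneq X$ with $gK\subseteq K$ is $K=\emptyset$. A compact minimal system $(X,g)$ is an infinite compact Hausdorff space $X$ with a minimal homeomorphism $g$ of $X$ (so $g$ is aperiodic). The topological full group $\tau[g]$ is the group of all homeomorphisms $h$ of $X$ for which there is a locally constant function $c:X\to\mathbb{Z}$ with $hx=g^{c(x)}x$ for all $x\in X$. Partial order: $x\le_g y$ iff $y=g^tx$ for some $t\ge 0$. Orbits are two-sided. For $h\in\tau[g]$, an $h$-orbit $\Omega$ is positive (with respect to $g$) if for all $y,z\in\Omega$ there is $n\in\mathbb{N}$ such that $h^{n'}y>_g z>_g h^{-n'}y$ for all $n'\ge n$; it is negative with respect to $g$ if it is positive with respect to $g^{-1}$. The index map is the unique group homomorphism $I:\tau[g]\to\mathbb{Z}$ with $I(g)=1$. Explicitly, writing $g^{\mathbb{N}}x=\{g^nx\mid n\ge 0\}$, for any choice of $x\in X$ one has $I(h)=|h^{-1}g^{\mathbb{N}}x\smallsetminus g^{\mathbb{N}}x|-|g^{\mathbb{N}}x\smallsetminus h^{-1}g^{\mathbb{N}}x|$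 (independent of $x$). *)

(* Defs.v *)
From HB Require Import structures.
From mathcomp Require Import all_boot all_order all_algebra finmap.
From mathcomp Require Import boolp classical_sets functions cardinality filter.
From mathcomp Require Import topology.

Set Implicit Arguments.
Unset Strict Implicit.
Unset Printing Implicit Defensive.

Local Open Scope classical_set_scope.

Record homeo (X : topologicalType) := Homeo {
  homeo_fun :> X -> X;
  homeo_inv : X -> X;
  homeoK : cancel homeo_fun homeo_inv;
  homeo_invK : cancel homeo_inv homeo_fun;
  homeo_cont : continuous homeo_fun;
  homeo_inv_cont : continuous homeo_inv }.

Section HomeoGroup.
Variable X : topologicalType.
Implicit Types f g h : homeo X.

Lemma homeoP f g : (f : X -> X) =1 g -> f = g.
Proof.
case: f g => [f f' fK f'K fc f'c] [g g' gK g'K gc g'c] /= /funext fg.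
subst g; have eg : f' = g' by apply/funext => x; rewrite -{1}[x]g'K fK.
by subst g'; f_equal; exact: Prop_irrelevance.
Qed.

Definition homeo_one : homeo X :=
  @Homeo X id id (fun=> erefl) (fun=> erefl)
    (fun x => cvg_id) (fun x => cvg_id).

Definition homeo_V h : homeo X :=
  Homeo (@homeo_invK X h) (@homeoK X h)
        (@homeo_inv_cont X h) (@homeo_cont X h).

Definition homeo_mul h g : homeo X.
Proof.
apply: (@Homeo X (h \o g) (homeo_inv g \o homeo_inv h)).
- by move=> x /=; rewrite !homeoK.
- by move=> x /=; rewrite !homeo_invK.
- move=> x; apply: continuous_comp; exact: homeo_cont.
- move=> x; apply: continuous_comp; exact: homeo_inv_cont.
Defined.

HB.instance Definition _ := gen_eqMixin (homeo X).
HB.instance Definition _ := gen_choiceMixin (homeo X).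

Fact homeo_mulA : associative homeo_mul.
Proof. by move=> f g h; exact: homeoP. Qed.

Fact homeo_mul1 : left_id homeo_one homeo_mul.
Proof. by move=> f; exact: homeoP. Qed.

Fact homeo_mulr1 : right_id homeo_one homeo_mul.
Proof. by move=> f; exact: homeoP. Qed.

Fact homeo_mulV : left_inverse homeo_one homeo_V homeo_mul.
Proof. by move=> f; apply: homeoP => x /=; rewrite homeoK. Qed.

Fact homeo_mulrV : right_inverse homeo_one homeo_V homeo_mul.
Proof. by move=> f; apply: homeoP => x /=; rewrite homeo_invK. Qed.

(* [(h * g)%g] is [h \o g], unlike the product of [{perm T}]. *)
HB.instance Definition _ := isGroup.Build (homeo X)
  homeo_mulA homeo_mul1 homeo_mulr1 homeo_mulV homeo_mulrV.

End HomeoGroup.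

Section Dynamics.
Variable X : topologicalType.
Implicit Types (g h : homeo X) (x y z : X) (O : set X).

Definition minimal g : Prop :=
  [set: X] !=set0 /\
  forall K : set X, closed K -> K `<` [set: X] -> g @` K `<=` K -> K = set0.

Definition compact_minimal_system g : Prop :=
  [/\ infinite_set [set: X], compact [set: X], hausdorff_space X & minimal g].

Definition zpow g (t : int) : homeo X :=
  match t with
  | Posz n => (g ^+ n)%g
  | Negz n => (g ^- n.+1)%g
  end.

Definition locally_constant (T : Type) (c : X -> T) : Prop :=
  forall x, \forall y \near x, c y = c x.

Definition topological_full_group g : set (homeo X) :=
  [set h | exists c : X -> int,
     locally_constant c /\ forall x, h x = zpow g (c x) x].

Definition orbit h x : set X := [set zpow h t x | t in [set: int]].

Definition is_orbit h O : Prop := exists x, O = orbit h x.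

Definition orbit_le g x y : Prop := exists n : nat, y = (g ^+ n)%g x.

Definition orbit_lt g x y : Prop := orbit_le g x y /\ x <> y.

Definition positive_orbit g h O : Prop :=
  is_orbit h O /\
  forall y z, O y -> O z -> exists n : nat, forall n' : nat, (n <= n')%N ->
    orbit_lt g z ((h ^+ n')%g y) /\ orbit_lt g ((h ^- n')%g y) z.

Definition negative_orbit g h O : Prop := positive_orbit g^-1%g h O.

Definition forward_orbit g x : set X := [set y | orbit_le g x y].

(* [fset_set] sends infinite sets to [fset0]; both differences are finite for
   [h] in the topological full group of [g], as its cocycle is bounded. *)
Definition index_at g x h : int :=
  (#|` fset_set (h^-1%g @` forward_orbit g x `\` forward_orbit g x)|%:Z
   - #|` fset_set (forward_orbit g x `\` h^-1%g @` forward_orbit g x)|%:Z)%R.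

(* Only the values of [I] on the topological full group matter. *)
Definition is_index_map g (I : homeo X -> int) : Prop :=
  {in topological_full_group g &, {morph I : h k / (h * k)%g >-> (h + k)%R}} /\
  I g = 1%R.

End Dynamics.

(* Main.v *)
(* On a g-orbit, in the coordinate n |-> g^n x, h is a bijection of Z with bounded
   jumps, and positive h-orbits are the orbits going from -oo to +oo.

   Counting orbits: each positive orbit crosses a level n in boundedly many steps
   from below n - L to above n + L, the number of steps depending on L only.  By
   density of g-orbits such finite pictures of k distinct orbits recur in every
   other g-orbit, at a fixed level, and the pigeonhole principle over L turns them
   into k distinct positive orbits there.

   Index: the value of the index is the net flow of the bijection across 0.  Along
   one orbit the flow telescopes to +1, -1 or 0 according as the orbit is positive,
   negative or neither.

   Uniqueness: the first return map g_U to a clopen set U differs from g by a torsion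
   element, so a homomorphism to Z with value 1 at g takes the value 1 at g_U.  If the
   cocycle of h is nonnegative with support U, the cocycle of g_U^-1 h is smaller on U,
   so that h is a product of maps g_U; the general case follows by composing h with
   powers of g. *)
Require Import Defs.
From mathcomp Require Import all_boot all_order all_algebra finmap zify.
From mathcomp Require Import boolp classical_sets functions cardinality filter.
From mathcomp Require Import topology.

Set Implicit Arguments.
Unset Strict Implicit.
Unset Printing Implicit Defensive.

Import Order.TTheory GRing.Theory Num.Theory.

Local Open Scope classical_set_scope.
Local Open Scope card_scope.

(** * Finite sums, iterates, representatives and a pigeonhole principle *)

Lemma eq_sum_support (T : eqType) (V : nmodType) (F : T -> V) (s t : seq T) :
  uniq s -> uniq t ->
  (forall i, F i != 0%R -> (i \in s) = (i \in t)) ->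
  (\sum_(i <- s) F i = \sum_(i <- t) F i)%R.
Proof.
move=> us ut st.
have E (r : seq T) : (\sum_(i <- r) F i = \sum_(i <- [seq i <- r | F i != 0]) F i)%R.
  rewrite (bigID (fun i => F i != 0%R)) /= [X in (_ + X)%R]big1 ?addr0 ?big_filter //.
  by move=> i; rewrite negbK => /eqP.
rewrite E [RHS]E; apply: perm_big; apply: uniq_perm; rewrite ?filter_uniq// => i.
by rewrite !mem_filter; case: eqVneq => //= Fi; exact: st.
Qed.

Lemma iter_cancel (T : Type) (f f' : T -> T) k :
  cancel f f' -> cancel (iter k f) (iter k f').
Proof. by move=> fK; elim: k => // k IH x; rewrite iterSr /= fK IH. Qed.

Lemma iter_cancel_sub (T : Type) (f f' : T -> T) k l x : cancel f f' ->
  (l <= k)%N -> iter l f' (iter k f x) = iter (k - l) f x.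
Proof. by move=> fK lk; rewrite -{1}(subnKC lk) iterD iter_cancel. Qed.

Lemma class_representatives (T : eqType) (R : T -> T -> Prop) (s : seq T) :
  (forall i, R i i) -> (forall i j, R i j -> R j i) ->
  (forall i j k, R i j -> R j k -> R i k) ->
  exists r : seq T, [/\ uniq r, {subset r <= s},
    forall i, i \in s -> exists2 j, j \in r & R j i &
    forall i j, i \in r -> j \in r -> R i j -> i = j].
Proof.
move=> R0 Rsym Rtr; elim: s => [|a s [r [ur rs sr rR]]]; first by exists [::].
have [[j jr ja]|na] := pselect (exists2 j, j \in r & R j a).
  exists r; split => //.
    by move=> i /rs is_; rewrite inE is_ orbT.
  by move=> i; rewrite inE => /predU1P[->|/sr//]; exists j.
exists (a :: r); split => /=.
- rewrite ur andbT; apply/negP => ar; apply: na; exists a => //.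
- by move=> i; rewrite !inE => /orP[->//|/rs ->]; rewrite orbT.
- move=> i; rewrite inE => /predU1P[->|/sr[j jr ji]].
    by exists a => //; rewrite inE eqxx.
  by exists j => //; rewrite inE jr orbT.
- move=> i j; rewrite !inE => /predU1P[->|ir] /predU1P[->|jr] // Rij.
  + by case: na; exists j => //; exact: Rsym.
  + by case: na; exists i.
  + exact: rR.
Qed.

(** If every [t] failed at some [N t], a [t] satisfying [P] at the maximum of [N] would, by
    antitonicity, satisfy it at [N t] too. *)
Lemma antitone_pigeonhole (T : finType) (P : nat -> T -> Prop) :
  (forall m n t, (m <= n)%N -> P n t -> P m t) ->
  (forall n, exists t, P n t) -> exists t, forall n, P n t.
Proof.
move=> anti ex; apply: contrapT => no.
have /choice[N Nt] : forall t, exists n, ~ P n t.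
  move=> t; apply: contrapT => Pt; apply: no; exists t => n.
  by apply: contrapT => nP; apply: Pt; exists n.
have [t Pt] := ex (\max_(t : T) N t).
by apply: (Nt t); apply: anti Pt; exact: leq_bigmax.
Qed.

(** * Bijections of the integers with bounded jumps *)

Section IntSequences.
Local Open Scope ring_scope.
Implicit Types (u : nat -> int) (a z : int) (k m : nat).

Definition tends_pinfty u := forall z, exists K, forall k, (K <= k)%N -> z < u k.
Definition tends_ninfty u := forall z, exists K, forall k, (K <= k)%N -> u k < z.

(** Each of the [m] values in [a, a + m) is taken at most once, so after the last such visit the
    sequence avoids the interval. *)
Lemma injective_leaves u a m : injective u ->
  exists K, forall k, (K <= k)%N -> u k < a \/ a + m%:Z <= u k.
Proof.
move=> iu; elim: m => [|m [K Kk]]; first by exists 0%N => k _; lia.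
have [[k0 uk0]|no] := pselect (exists k0, u k0 = a + m%:Z).
  exists (maxn K k0.+1) => k; rewrite geq_max => /andP[/Kk Hk k0k].
  have : u k <> u k0 by move=> /iu ?; lia.
  by rewrite uk0; lia.
exists K => k /Kk Hk; have : u k <> a + m%:Z by move=> ?; apply: no; exists k.
by lia.
Qed.

Lemma injective_bounded_below u a : injective u -> (forall k, a <= u k) ->
  tends_pinfty u.
Proof.
move=> iu au z; have [K Kk] := injective_leaves a `|z - a|.+1 iu.
by exists K => k /Kk; move: (au k); lia.
Qed.

Lemma injective_bounded_above u a : injective u -> (forall k, u k <= a) ->
  tends_ninfty u.
Proof.
move=> iu au z; have [K Kk] := injective_leaves z `|a - z|.+1 iu.
by exists K => k /Kk; move: (au k); lia.
Qed.

(** From time [K] on the sequence avoids [z - m, z], and a descent of at most [m] per step cannot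
    jump over this interval: once above [z], it stays above. *)
Lemma unbounded_tends_pinfty u m : injective u ->
  (forall k, u k - m%:Z <= u k.+1) ->
  (forall z, exists k, z < u k) -> tends_pinfty u.
Proof.
move=> iu um unb z; have [K Kk] := injective_leaves (z - m%:Z) m.+1 iu.
have [y yK] : exists y : int, forall k, (k < K)%N -> u k <= y.
  elim: K {Kk} => [|K [y yK]]; first by exists 0.
  exists (`|y| + `|u K|)%N%:Z => k; rewrite ltnS leq_eqVlt => /predU1P[->|/yK]; lia.
have [k0 k0y] := unb (`|y| + `|z|)%N%:Z.
have Kk0 : (K <= k0)%N by rewrite leqNgt; apply/negP => /yK; lia.
exists k0 => k /subnK <-; elim: (k - k0)%N => [|i IH]; first by rewrite add0n; lia.
have := um (i + k0)%N; have := Kk (i.+1 + k0)%N; rewrite addSn; lia.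
Qed.

Lemma unbounded_tends_ninfty u m : injective u ->
  (forall k, u k.+1 <= u k + m%:Z) ->
  (forall z, exists k, u k < z) -> tends_ninfty u.
Proof.
move=> iu um unb z.
have [||x|K KP] := @unbounded_tends_pinfty (fun k => - u k) m _ _ _ (- z).
- by move=> i j /oppr_inj /iu.
- by move=> k; have := um k; lia.
- by have [k] := unb (- x); exists k; lia.
- by exists K => k /KP; lia.
Qed.

Lemma injective_tends_infty u m : injective u ->
  (forall k, u k - m%:Z <= u k.+1) ->
  tends_pinfty u \/ tends_ninfty u.
Proof.
move=> iu um; have [unb|/existsNP[z zu]] := pselect (forall z, exists k, z < u k).
  by left; exact: unbounded_tends_pinfty unb.
right; apply: (@injective_bounded_above _ z) => // k.
by rewrite leNgt; apply/negP => ?; apply: zu; exists k.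
Qed.

End IntSequences.

(** * Orbits of a bijection of the integers and their flow across 0 *)

Section IntBijections.
Local Open Scope ring_scope.
Implicit Types (f : int -> int) (i j n p q : int).

(** Only iterates of [f] appear, so no inverse has to be named; injectivity of [f] gives
    transitivity. *)
Definition same_orbit f p q := exists k, q = iter k f p \/ p = iter k f q.

Lemma same_orbit_refl f p : same_orbit f p p.
Proof. by exists 0%N; left. Qed.

Lemma same_orbit_sym f p q : same_orbit f p q -> same_orbit f q p.
Proof. by case=> k [] ->; exists k; [right|left]. Qed.

Lemma iter_inj f k : injective f -> injective (iter k f).
Proof. by move=> fi; elim: k => [|k IH] i j //= /fi /IH. Qed.

Lemma same_orbit_trans f p q r : injective f ->
  same_orbit f p q -> same_orbit f q r -> same_orbit f p r.
Proof.
move=> fi [k Hk] [l Hl].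
case: Hk => [Hk|Hk]; case: Hl => [Hl|Hl].
- by exists (l + k)%N; left; rewrite iterD -Hk.
- have [kl|/ltnW lk] := leqP k l.
    exists (l - k)%N; right; apply: (@iter_inj _ k fi).
    by rewrite -Hk -iterD subnKC.
  exists (k - l)%N; left; apply: (@iter_inj _ l fi).
  by rewrite -iterD subnKC // -Hl.
- have [kl|/ltnW lk] := leqP k l.
    by exists (l - k)%N; left; rewrite Hl Hk -iterD subnK.
  by exists (k - l)%N; right; rewrite Hl Hk -iterD subnK.
- by exists (k + l)%N; right; rewrite iterD -Hl.
Qed.

Lemma same_orbit_inverse f f' p q : cancel f f' -> cancel f' f ->
  same_orbit f p q -> same_orbit f' p q.
Proof.
move=> fK f'K [k [->|->]]; exists k; [right|left];
  by rewrite iter_cancel.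
Qed.

(** [f'] stands for the inverse of [f]; with the two exchanged, the predicate describes the orbits
    running from +oo down to -oo. *)
Definition ascending f f' p :=
  tends_pinfty (fun k => iter k f p) /\ tends_ninfty (fun k => iter k f' p).

Lemma ascending_step f f' p : cancel f f' ->
  ascending f f' p -> ascending f f' (f p).
Proof.
move=> fK [up dn]; split=> z.
  by have [K KP] := up z; exists K => k Kk; rewrite -iterSr; apply: KP; exact: leqW.
by have [K KP] := dn z; exists K.+1 => -[//|k] Kk; rewrite iterSr fK; apply: KP.
Qed.

Lemma ascending_step_inverse f f' p : cancel f' f ->
  ascending f f' p -> ascending f f' (f' p).
Proof.
move=> f'K [up dn]; split=> z.
  by have [K KP] := up z; exists K.+1 => -[//|k] Kk; rewrite iterSr f'K; apply: KP.
by have [K KP] := dn z; exists K => k Kk; rewrite -iterSr; apply: KP; exact: leqW.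
Qed.

Lemma ascending_same_orbit f f' p q : cancel f f' -> cancel f' f ->
  same_orbit f p q -> ascending f f' p -> ascending f f' q.
Proof.
move=> fK f'K [k [->|pE]] ap.
  by elim: k => [//|k IH]; apply: ascending_step.
have -> : q = iter k f' p by rewrite pE iter_cancel.
by elim: k {pE} => [//|k IH]; apply: ascending_step_inverse.
Qed.

Lemma aperiodic_iter_inj f p : injective f ->
  (forall k, iter k.+1 f p != p) -> injective (fun k => iter k f p).
Proof.
move=> fi ap.
have H k l : (k <= l)%N -> iter k f p = iter l f p -> k = l.
  move=> kl; rewrite -(subnKC kl) iterD => /(iter_inj fi) E.
  case: (l - k)%N E => [|m E]; first by rewrite addn0.
  by have := ap m; rewrite -E eqxx.
move=> k l; have [kl|/ltnW lk] := leqP k l; first exact: H.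
by move=> /esym /H ->.
Qed.

Lemma iter_periodic f p m k : iter m f p = p -> iter (k * m) f p = p.
Proof. by move=> E; elim: k => // k IH; rewrite mulSn addnC iterD E IH. Qed.

Lemma ascending_aperiodic f f' p k : ascending f f' p -> iter k.+1 f p != p.
Proof.
move=> [up _]; apply/eqP => E; have [K KP] := up p.
by have := KP (K * k.+1)%N; rewrite iter_periodic // leq_pmulr // ltxx => /(_ isT).
Qed.

Lemma ascending_iter_inj f f' p : injective f -> ascending f f' p ->
  injective (fun k => iter k f p).
Proof.
by move=> fi ap; apply: aperiodic_iter_inj => // k; exact: ascending_aperiodic ap.
Qed.

Lemma aperiodic_inverse f f' p k : cancel f' f ->
  iter k.+1 f p != p -> iter k.+1 f' p != p.
Proof.
move=> f'K; apply: contra => /eqP E; apply/eqP.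
by rewrite -{1}E iter_cancel.
Qed.

(* The flow across 0 carried by the arrow from [i] to [f i]. *)
Definition crossing f i : int := ((0 <= f i)%R : nat)%:Z - ((0 <= i)%R : nat)%:Z.

Definition net_flow f (s : seq int) := \sum_(i <- s) crossing f i.

Lemma telescope_crossing f p k :
  \sum_(i <- [seq iter l f p | l <- iota 0 k]) crossing f i =
  ((0 <= iter k f p)%R : nat)%:Z - ((0 <= p)%R : nat)%:Z.
Proof.
elim: k => [|k IH]; first by rewrite big_nil subrr.
rewrite -[in iota _ _]addn1 iotaD map_cat big_cat IH big_seq1 /= add0n /crossing /=.
by rewrite addrC addrA subrK.
Qed.


(** The limit is recorded as a boolean, so that the behaviours at the two ends of an orbit can be
    combined by cases. *)
Lemma eventual_sign (u : nat -> int) m : injective u ->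
  (forall k, u k - m%:Z <= u k.+1) ->
  exists b K, [/\ forall k, (K <= k)%N -> (0 <= u k) = b,
    tends_pinfty u <-> b & tends_ninfty u <-> ~~ b].
Proof.
move=> iu um; have disj : tends_pinfty u -> tends_ninfty u -> False.
  move=> /(_ 0)[K KP] /(_ 0)[K' KP']; have := KP (maxn K K'); have := KP' (maxn K K').
  by rewrite leq_maxl leq_maxr; lia.
have [up|dn] := injective_tends_infty iu um.
  have [K KP] := up 0; exists true, K; split => //; first by move=> k /KP; lia.
  by split=> // /(disj up).
have [K KP] := dn 0; exists false, K; split => //; first by move=> k /KP; lia.
by split=> // /disj /(_ dn).
Qed.

Definition jumps_le f (M : nat) := forall n, n - M%:Z <= f n <= n + M%:Z.

Lemma jumps_le_inverse f f' M : cancel f' f -> jumps_le f M -> jumps_le f' M.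
Proof. by move=> f'K fM n; have := fM (f' n); rewrite f'K; lia. Qed.

(** The orbit is a cycle, and along one full turn the crossings telescope to 0. *)
Lemma sum_crossing_periodic f p m s : injective f -> iter m.+1 f p = p ->
  uniq s -> (forall i, crossing f i != 0 -> i \in s) ->
  \sum_(i <- s | `[< same_orbit f p i >]) crossing f i = 0.
Proof.
move=> fi per us sP; rewrite big_mkcond /=.
have ex : exists k, (0 < k)%N && (iter k f p == p) by exists m.+1; rewrite per eqxx.
(* Minimality of the period makes the points of one turn pairwise distinct. *)
case: (ex_minnP ex) => {per ex m} m /andP[m0 /eqP per] mmin.
rewrite (@eq_sum_support _ _ _ _ [seq iter l f p | l <- iota 0 m]) //.
- rewrite (eq_big_seq (crossing f)); last first.
    move=> i /mapP[l _ ->]; rewrite ifT //; apply/asboolP; exists l; by left.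
  by rewrite telescope_crossing per subrr.
- rewrite map_inj_in_uniq ?iota_uniq // => k l.
  rewrite !mem_iota !add0n /= => km lm.
  have H a b : (a <= b)%N -> (b < m)%N -> iter a f p = iter b f p -> a = b.
    move=> ab bm; rewrite -{1}(subnKC ab) iterD => /(iter_inj fi) E.
    case: (posnP (b - a)%N) => [|ba0]; first by lia.
    by have := mmin (b - a)%N; rewrite ba0 -E eqxx => /(_ isT); lia.
  have [kl|/ltnW lk] := leqP k l; first exact: H.
  by move=> /esym /H -> .
- move=> i; case: ifPn => [/asboolP pi /sP ->|]; last by rewrite eqxx.
  suff [k ->] : exists k, i = iter k f p.
    apply/esym/mapP; exists (k %% m)%N; first by rewrite mem_iota add0n ltn_mod.
    by rewrite {1}(divn_eq k m) addnC iterD iter_periodic.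
  case: pi => k [->|pE]; first by exists k.
  have iper : iter m f i = i.
    by apply: (@iter_inj _ k fi); rewrite -iterD addnC iterD -pE per.
  (* On a cycle of period [m], going back [k] steps is going forward [k * m - k] steps. *)
  exists (k * m - k)%N; rewrite pE -iterD subnK ?leq_pmulr //.
  by rewrite iter_periodic.
Qed.

(** Far out along an aperiodic orbit the sign is constant in each direction, so the crossings
    telescope to the sign at the forward end minus the sign at the backward end. *)
Lemma sum_crossing_orbit f f' M p s : cancel f f' -> cancel f' f ->
  jumps_le f M -> uniq s -> (forall i, crossing f i != 0 -> i \in s) ->
  \sum_(i <- s | `[< same_orbit f p i >]) crossing f i =
  (`[< ascending f f' p >] : nat)%:Z - (`[< ascending f' f p >] : nat)%:Z.
Proof.
move=> fK f'K fM us sP.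
have [[k per]|ap] := pselect (exists k, iter k.+1 f p = p).
  rewrite (sum_crossing_periodic (can_inj fK) per us sP).
  have per' : iter k.+1 f' p = p by rewrite -{1}per iter_cancel.
  rewrite !asboolF ?subrr // => a.
    by have := ascending_aperiodic k a; rewrite per' eqxx.
  by have := ascending_aperiodic k a; rewrite per eqxx.
have f'M := jumps_le_inverse f'K fM.
have ap1 k : iter k.+1 f p != p by apply/eqP => E; apply: ap; exists k.
have ui := aperiodic_iter_inj (can_inj fK) ap1.
have vi := aperiodic_iter_inj (can_inj f'K) (fun k => aperiodic_inverse f'K (ap1 k)).
have [|a [K [aP up un]]] := eventual_sign (m := M) ui.
  by move=> k; have := fM (iter k f p); rewrite /=; lia.
have [|b [L [bP vp vn]]] := eventual_sign (m := M) vi.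
  by move=> k; have := f'M (iter k f' p); rewrite /=; lia.
have -> : `[< ascending f f' p >] = a && ~~ b.
  by apply/asboolP/andP; rewrite /ascending up vn.
have -> : `[< ascending f' f p >] = ~~ a && b.
  by apply/asboolP/andP; rewrite /ascending vp un => -[].
rewrite big_mkcond /=.
(* The arrows kept start at the times from -L to K; every earlier or later arrow joins two points of
   equal sign. *)
rewrite (@eq_sum_support _ _ _ _ [seq iter l f (iter L f' p) | l <- iota 0 (K.+1 + L)]) //.
- rewrite (eq_big_seq (crossing f)); last first.
    move=> i /mapP[l _ ->]; rewrite ifT //; apply/asboolP.
    apply: (@same_orbit_trans _ _ (iter L f' p)); first exact: can_inj fK.
      by exists L; right; rewrite iter_cancel.
    by exists l; left.
  rewrite telescope_crossing iterD (iter_cancel _ f'K) aP // bP //.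
  by case: (a); case: (b).
- rewrite map_inj_in_uniq ?iota_uniq // => k l _ _ E; apply: ui.
  apply: (@iter_inj _ L (can_inj f'K)) => /=.
  have H (j : nat) : iter j f (iter L f' p) = iter L f' (iter j f p).
    apply: (@iter_inj _ L (can_inj fK)).
    by rewrite -iterD addnC iterD !(iter_cancel _ f'K).
  by rewrite -!H.
- move=> i; case: ifPn => [/asboolP pi ci|]; last by rewrite eqxx.
  rewrite (sP _ ci); apply/esym/mapP; case: pi => k [iE|pE].
    have [kK|Kk] := ltnP k K.
      by exists (k + L)%N; [rewrite mem_iota; lia | rewrite iterD iter_cancel].
    move: ci; rewrite /crossing iE -iterS !aP ?subrr //; exact: leqW.
  have iE : i = iter k f' p by rewrite pE iter_cancel.
  have [kL|Lk] := leqP k L.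
    exists (L - k)%N; first by rewrite mem_iota; lia.
    by rewrite iE -{2}(subnK kL) iterD (iter_cancel _ f'K).
  move: ci; rewrite /crossing iE; case: k Lk {pE iE} => // k Lk.
  by rewrite (bP k.+1 (leqW Lk)) iterS f'K (bP k Lk) subrr.
Qed.

(** Exchanging the sums assigns every arrow of [s] to the unique representative of its orbit, which
    leaves 1, -1 or 0 per representative. *)
Lemma net_flow_representatives f f' M s (r : seq int) : cancel f f' -> cancel f' f ->
  jumps_le f M -> uniq s -> (forall i, crossing f i != 0 -> i \in s) ->
  uniq r -> (forall i, i \in s -> exists2 j, j \in r & same_orbit f j i) ->
  (forall i j, i \in r -> j \in r -> same_orbit f i j -> i = j) ->
  net_flow f s = (count (fun j => `[< ascending f f' j >]) r)%:Z -
                 (count (fun j => `[< ascending f' f j >]) r)%:Z.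
Proof.
move=> fK f'K fM us sP ur sr rr.
transitivity (\sum_(j <- r) \sum_(i <- s | `[< same_orbit f j i >]) crossing f i).
  under eq_bigr do rewrite big_mkcond.
  rewrite exchange_big /net_flow /=; apply: eq_big_seq => i /sr[j jr ji].
  rewrite (bigD1_seq j) //= asboolT // big_seq_cond big1 ?addr0 // => l /andP[lr lj].
  rewrite asboolF // => li; move/eqP: lj; apply; apply: rr => //.
  by apply: (same_orbit_trans (can_inj fK) li); exact: same_orbit_sym.
under eq_bigr do rewrite (sum_crossing_orbit _ fK f'K fM us sP).
elim: (r) => [|j t IH]; first by rewrite big_nil.
by rewrite big_cons IH /=; lia.
Qed.

(** * Finite pictures of ascending orbits and their recurrence *)

(** The bound on the number of steps involves [L] only, neither the orbit nor [n]: the crossing is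
    visible in a window of controlled size. *)
Lemma ascending_crosses f f' M p n (L : nat) : cancel f f' -> cancel f' f ->
  jumps_le f M -> ascending f f' p ->
  exists q, [/\ same_orbit f p q, n - M%:Z <= q <= n &
    exists j i : nat, [/\ (j <= L.*2.+1)%N, (i <= L.*2.+1)%N,
      n + L%:Z < iter j f q & iter i f' q <= n - L%:Z]].
Proof.
move=> fK f'K fM ap; have [up dn] := ap.
have [K KP] := dn (n - L%:Z); set p0 := iter K f' p.
have pp0 : same_orbit f p p0 by exists K; right; rewrite iter_cancel.
have ap0 := ascending_same_orbit fK f'K pp0 ap.
have ui := ascending_iter_inj (can_inj fK) ap0.
set u := fun k => iter k f p0 in ui.
have u0 : u 0%N <= n - L%:Z by have := KP K (leqnn K); rewrite /u /p0 /=; lia.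
(* [b] will be the first time above n + L; [a] and [c] the last times up to [b] at or below n - L
   and n. The point sought is [u c]. *)
have exb : exists k, n + L%:Z < u k.
  by have [k kP] := ap0.1 (n + L%:Z); exists k; exact: kP.
case: (ex_minnP exb) => b ub bmin.
have exa : exists k, (k <= b)%N && (u k <= n - L%:Z) by exists 0%N.
have exc : exists k, (k <= b)%N && (u k <= n)
  by exists 0%N; rewrite leq0n /=; move: u0 => /=; lia.
have bd (P : pred nat) k : (k <= b)%N && P k -> (k <= b)%N by case/andP.
case: (ex_maxnP exa (bd _)) => a /andP[ab ua] amax.
case: (ex_maxnP exc (bd _)) => c /andP[cb uc] cmax.
have ac : (a <= c)%N by apply: cmax; rewrite ab /=; lia.
have cb' : (c < b)%N.
  by rewrite ltn_neqAle cb andbT; apply/eqP => cbE; move: uc; rewrite cbE; lia.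
(* Strictly between the times [a] and [b] the path stays in an interval of length [2L]. *)
have len : (b - a.+1 <= L.*2)%N.
  rewrite -(size_iota 0 L.*2) -(size_map (fun l : nat => n - L%:Z + 1 + l%:Z)).
  rewrite -[X in (X <= _)%N](size_iota a.+1) -(size_map u).
  apply: uniq_leq_size; first by rewrite map_inj_uniq ?iota_uniq.
  move=> _ /mapP[l lP ->]; move: lP; rewrite mem_iota => lP.
  have lb : ~~ (n + L%:Z < u l) by apply/negP => /bmin; lia.
  have la : ~~ (u l <= n - L%:Z).
    by apply/negP => ul; have := amax l; rewrite ul andbT => H; have := H; lia.
  apply/mapP; exists `|(u l - (n - L%:Z + 1))%R|%N; first by rewrite mem_iota; lia.
  by lia.
exists (u c); split.
- by apply: (same_orbit_trans (can_inj fK) pp0); exists c; left.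
- have uSc : ~~ (u c.+1 <= n).
    by apply/negP => H; have := cmax c.+1; rewrite H andbT => /(_ cb'); rewrite ltnn.
  by have := fM (u c); rewrite -[f (u c)]/(u c.+1); lia.
exists (b - c)%N, (c - a)%N; split; [lia|lia| |].
- by rewrite /u -iterD subnK // ltnW.
- by rewrite /u -{2}(subnKC ac) addnC iterD iter_cancel.
Qed.

Lemma iter_bounded_jump f M p k : jumps_le f M ->
  p - (k * M)%N%:Z <= iter k f p <= p + (k * M)%N%:Z.
Proof.
move=> fM; elim: k => [|k IH]; first by rewrite mul0n /=; lia.
by rewrite iterS mulSn; have := fM (iter k f p); lia.
Qed.

(** The pattern of [f] around [n] reappears in [h] around 0. The shift to 0 leaves only finitely
    many start points for the pigeonhole principle. *)
Definition agree_on_window f h (R : nat) n :=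
  forall i, - R%:Z <= i <= R%:Z -> h i = f (i + n) - n.

Lemma agree_iter f h (M R : nat) n q k : jumps_le h M -> agree_on_window f h R n ->
  - M%:Z <= q <= 0 -> (M + k * M <= R)%N -> iter k h q = iter k f (q + n) - n.
Proof.
move=> hM fh qM; elim: k => [|k IH] kR; first by rewrite /= addrK.
rewrite !iterS fh; last by have := iter_bounded_jump q k hM; move: kR; rewrite mulSn; lia.
by rewrite IH ?subrK //; move: kR; rewrite mulSn; lia.
Qed.

(** The radius shrinks by [M] because [h' i] can lie that far outside the smaller window. *)
Lemma agree_inverse f f' h h' (M R : nat) n : cancel f f' -> cancel h' h ->
  jumps_le h M -> agree_on_window f h (R + M) n -> agree_on_window f' h' R n.
Proof.
move=> fK h'K hM fh i iR; have hi := fh (h' i).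
have := hM (h' i); rewrite h'K => hj.
have -> : i + n = f (h' i + n) by rewrite h'K in hi; have := hi _; lia.
by rewrite fK addrK.
Qed.

(** For every [L], the crossings of the [k] orbits at a common level [n] are copied to paths of [h]
    starting in [-M, 0]. There are finitely many tuples of such start points, so one tuple serves
    all [L]. *)
Lemma ascending_family_approx f f' h h' M k (p : 'I_k -> int) :
  cancel f f' -> cancel f' f -> cancel h h' -> cancel h' h ->
  jumps_le f M -> jumps_le h M ->
  (forall R : nat, exists n, agree_on_window f h R n) ->
  (forall a, ascending f f' (p a)) ->
  (forall a b, a != b -> ~ same_orbit f (p a) (p b)) ->
  exists q : 'I_k -> int, (forall a, ascending h h' (q a)) /\
    (forall a b, a != b -> ~ same_orbit h (q a) (q b)).
Proof.
move=> fK f'K hK h'K fM hM fh pa pn.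
have h'M := jumps_le_inverse h'K hM.
pose pt (t : {ffun 'I_k -> 'I_M.+1}) a : int := - (t a : nat)%:Z.
pose P (L : nat) (t : {ffun 'I_k -> 'I_M.+1}) :=
  (forall a, (exists j : nat, L%:Z < iter j h (pt t a)) /\
             (exists i : nat, iter i h' (pt t a) <= - L%:Z)) /\
  (forall a b (j : nat), a != b -> (j <= L)%N -> iter j h (pt t a) <> pt t b).
have [|L|t tP] := @antitone_pigeonhole _ P.
- move=> m n t mn [t1 t2]; split.
    move=> a; have [[j jP] [i iP]] := t1 a; split; [exists j|exists i]; lia.
  by move=> a b j ab jm; apply: t2 => //; lia.
(* Radius [R] covers 2L + 1 jumps from a start point in [-M, 0]; the extra [M] is consumed by
   passing to the inverse. *)
- pose R := (M + L.*2.+1 * M)%N; have [n fhn] := fh (R + M)%N.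
  have fhR : agree_on_window f h R n by move=> i iR; apply: fhn; lia.
  have fhR' := agree_inverse fK h'K hM fhn.
  have [q qP] := choice (fun a => ascending_crosses n L fK f'K fM (pa a)).
  exists [ffun a => inord `|(n - q a)%R|%N].
  have ptE a : pt [ffun a => inord `|(n - q a)%R|%N] a = q a - n.
    by have [_ qn _] := qP a; rewrite /pt ffunE inordK; lia.
  have qM a : - M%:Z <= q a - n <= 0 by have [_ qn _] := qP a; lia.
  have RP (j : nat) : (j <= L.*2.+1)%N -> (M + j * M <= R)%N.
    by move=> jL; rewrite leq_add2l leq_mul2r jL orbT.
  split=> [a|a b j ab jL]; rewrite !ptE.
    have [_ _ [j [i [jL iL jP iP]]]] := qP a; split; [exists j|exists i].
      by rewrite (agree_iter hM fhR (qM a)) ?RP // subrK; lia.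
    by rewrite (agree_iter h'M fhR' (qM a)) ?RP // subrK; lia.
  rewrite (agree_iter hM fhR (qM a)) ?RP //; last by lia.
  rewrite subrK => /addIr E; apply: (pn a b ab).
  have [qa _ _] := qP a; have [qb _ _] := qP b.
  apply: (same_orbit_trans (can_inj fK) qa).
  apply: (same_orbit_trans (can_inj fK) _ (same_orbit_sym qb)).
  by exists j; left.
exists (pt t); split => [a|a b ab [j [E|E]]].
- have [t1 _] := tP 0%N.
  have up z : exists j : nat, z < iter j h (pt t a).
    by have [/(_ a)[[j jP] _] _] := tP `|z|%N; exists j; lia.
  have dn z : exists j : nat, iter j h' (pt t a) < z.
    by have [/(_ a)[_ [j jP]] _] := tP `|z|.+1%N; exists j; lia.
  (* A periodic orbit is bounded, against [up]. Aperiodicity and bounded jumps then upgrade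
     unboundedness to convergence. *)
  have ap (j : nat) : iter j.+1 h (pt t a) != pt t a.
    apply/eqP => E; have [z zP] : exists z : int, forall l : nat, iter l h (pt t a) <= z.
      exists (pt t a + (j.+1 * M)%N%:Z) => l.
      rewrite (divn_eq l j.+1) addnC iterD iter_periodic //.
      have /andP[_ H] := iter_bounded_jump (pt t a) (l %% j.+1) hM; apply: (le_trans H).
      by rewrite lerD2l lez_nat leq_mul2r ltnW ?orbT // ltn_mod.
    by have [l] := up z; rewrite ltNge zP.
  split.
    apply: (@unbounded_tends_pinfty _ M) up; first exact: (aperiodic_iter_inj (can_inj hK) ap).
    by move=> l; have := hM (iter l h (pt t a)); rewrite iterS; lia.
  apply: (@unbounded_tends_ninfty _ M) dn.
    by apply: (aperiodic_iter_inj (can_inj h'K)) => l; exact: (aperiodic_inverse h'K).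
  by move=> l; have := h'M (iter l h' (pt t a)); rewrite iterS; lia.
- by have [_ /(_ a b j ab (leqnn j))] := tP j; rewrite E.
- have [_ H] := tP j; apply: (H b a j) => //; by rewrite eq_sym.
Qed.
End IntBijections.

(** * The topological full group *)

Section Powers.
Variable X : topologicalType.
Implicit Types (g h : homeo X) (x y : X) (n m : int).
Local Open Scope ring_scope.

Lemma homeo_expE h k x : (h ^+ k)%g x = iter k h x.
Proof. by elim: k => [|k IH] //; rewrite expgS /= -IH. Qed.

Lemma homeo_expVE h k x : (h ^- k)%g x = iter k (h^-1)%g x.
Proof. by rewrite -expVgn homeo_expE. Qed.

Lemma zpowS g n x : zpow g (n + 1) x = g (zpow g n x).
Proof.
case: n => [k|k].
  by rewrite -[Posz k + 1]/(Posz (k + 1)) addn1 /zpow expgS.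
case: k => [|k].
  by rewrite /= expg1 (homeo_invK g).
have -> : Negz k.+1 + 1 = Negz k by lia.
by rewrite /zpow !homeo_expVE iterS (homeo_invK g).
Qed.

Lemma zpowP g n x : zpow g (n - 1) x = homeo_inv g (zpow g n x).
Proof. by rewrite -[in RHS](subrK 1 n) zpowS homeoK. Qed.

Lemma zpowD g m n x : zpow g (m + n) x = zpow g m (zpow g n x).
Proof.
elim/int_rec: m => [|k IH|k IH]; first by rewrite add0r.
  by rewrite -addn1 PoszD addrAC zpowS IH zpowS.
have -> : - (k.+1%:Z) + n = (- k%:Z + n) - 1 by lia.
have -> : - (k.+1%:Z) = - k%:Z - 1 by lia.
by rewrite !zpowP IH.
Qed.

Lemma zpowK g n : cancel (zpow g n) (zpow g (- n)).
Proof. by move=> x; rewrite -zpowD addNr. Qed.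

Lemma zpow_nat g (k : nat) x : zpow g k x = iter k g x.
Proof. exact: homeo_expE. Qed.

Lemma zpowN g n x : zpow (g^-1)%g n x = zpow g (- n) x.
Proof.
case: n => [[|k]|k] //.
  by rewrite -[- Posz k.+1]/(Negz k) /zpow homeo_expVE homeo_expE.
have -> : - Negz k = Posz k.+1 by lia.
by rewrite /zpow expVgn invgK.
Qed.

End Powers.

Section TopologicalLemmas.
Variable X : topologicalType.
Implicit Types (g h : homeo X) (x y : X).

Lemma locally_constant_comp (T : Type) (c : X -> T) (f : X -> X) :
  continuous f -> locally_constant c -> locally_constant (c \o f).
Proof. by move=> fc cc x; exact: (fc x _ (cc (f x))). Qed.

Lemma locally_constant2 (S T U : Type) (F : S -> T -> U) (b : X -> S) (c : X -> T) :
  locally_constant b -> locally_constant c -> locally_constant (fun x => F (b x) (c x)).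
Proof. by move=> bc cc x; apply: filterS2 (bc x) (cc x) => y -> ->. Qed.

Lemma locally_constant_bounded (c : X -> int) : compact [set: X] ->
  locally_constant c -> exists M : nat, forall x, (- M%:Z <= c x <= M%:Z)%R.
Proof.
move=> /compact_near_coveringP cX cc.
have /(_ _)[|M _ MP] := cX nat \oo (fun M x => (`|c x| <= M)%N) _.
  move=> x _; exists ([set y | c y = c x], [set M | (`|c x| <= M)%N]) => /=.
    by split; [exact: cc|exact: nbhs_infty_ge].
  by move=> [y M] /= [-> ].
by exists M => x; have := MP M (leqnn M) x I; lia.
Qed.

Lemma locally_constant_set (A : set X) : locally_constant A -> open A.
Proof.
by move=> Ac; rewrite openE => x Ax; have := Ac x; apply: filterS => y ->.
Qed.

Lemma near_forall_lt (P : nat -> X -> Prop) x k :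
  (forall i, \forall y \near x, P i y) ->
  \forall y \near x, forall i, (i < k)%N -> P i y.
Proof.
move=> Px; elim: k => [|k IH]; first by apply: nearW.
by apply: filterS2 (Px k) IH => y Pk IH i; rewrite ltnS leq_eqVlt => /predU1P[->|/IH].
Qed.

End TopologicalLemmas.

(** * Minimality and cocycles *)

Section Minimal.
Variable X : topologicalType.
Implicit Types (g h k : homeo X) (x y : X).

Lemma minimal_invariant_setT g (K : set X) : minimal g -> closed K -> K !=set0 ->
  g @` K `<=` K -> K = setT.
Proof.
move=> [_ gmin] cK K0 gK; apply: contrapT => KT.
have K_eq0 : K = set0.
  by apply: gmin => //; split=> // TK; apply: KT; apply/seteqP; split.
by case: K0 => x; rewrite K_eq0.
Qed.

(** The closure of a forward orbit is nonempty, closed and stable under [g], hence everything. *)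
Lemma minimal_orbit_dense g (V : set X) x : minimal g -> open V -> V !=set0 ->
  exists n, V (iter n g x).
Proof.
move=> gmin oV [v Vv].
have KT : closure (range (fun n => iter n g x)) = setT.
  apply: (minimal_invariant_setT gmin); first exact: closed_closure.
    by exists x; apply: subset_closure; exists 0%N.
  move=> _ [y Ky <-] B /(@homeo_cont _ g y) /Ky[_ [[n _ <-] Bn]].
  by exists (g (iter n g x)); split => //; exists n.+1.
have : closure (range (fun n => iter n g x)) v by rewrite KT.
by move=> /(_ V (open_nbhs_nbhs (conj oV Vv)))[_ [[n _ <-] Vn]]; exists n.
Qed.

(** A periodic orbit would be a finite, hence closed, stable set, and so exhaust the infinite
    space. *)
Lemma minimal_aperiodic g x n : compact_minimal_system g -> iter n.+1 g x <> x.
Proof.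
move=> [Xinf _ hX gmin] per; apply: Xinf.
have fO : finite_set ((fun i => iter i g x) @` `I_n.+1).
  by apply: finite_image; exact: finite_II.
suff <- : (fun i => iter i g x) @` `I_n.+1 = setT by [].
apply: (minimal_invariant_setT gmin).
- by have [acc _] := @accessible_finite_set_closed X; exact: acc (hausdorff_accessible hX) _ fO.
- by exists x, 0%N.
- move=> _ [_ [i /= iN <-] <-]; rewrite -iterS.
  have [->|iN'] := eqVneq i n; first by rewrite per; exists 0%N.
  by exists i.+1 => //=; lia.
Qed.

Lemma zpow_inj g x : compact_minimal_system g -> injective (fun n => zpow g n x).
Proof.
move=> gmin.
have H (m n : int) : (m <= n)%R -> zpow g m x = zpow g n x -> m = n.
  move=> mn E; have nE : n = (m + `|(n - m)%R|%N%:Z)%R by lia.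
  move: E; rewrite [in zpow g n x]nE zpowD => /(can_inj (zpowK g m)).
  rewrite zpow_nat; case: absz nE => [|k] nE; first by move=> _; lia.
  by move/esym/(minimal_aperiodic gmin).
move=> m n; have [mn|/ltW nm] := leP m n; first exact: H.
by move=> /esym /H ->.
Qed.

Definition cocycle g h (c : X -> int) :=
  locally_constant c /\ forall x, h x = zpow g (c x) x.

Lemma cocycle_continuous g (c : X -> int) (f : X -> X) :
  locally_constant c -> (forall x, f x = zpow g (c x) x) -> continuous f.
Proof.
move=> cc fE x B /=; rewrite fE => /(@homeo_cont _ (zpow g (c x)) x) BV.
by apply: filterS2 (cc x) BV => y cy By; rewrite /= fE cy.
Qed.

Lemma cocycleM g h k c d : cocycle g h c -> cocycle g k d ->
  cocycle g (h * k)%g (fun x => c (k x) + d x)%R.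
Proof.
move=> [cc hE] [dc kE]; split => [|x].
  by apply: locally_constant2 => //; apply: locally_constant_comp => //; exact: homeo_cont.
by rewrite /= hE [in RHS]zpowD -kE.
Qed.

Lemma cocycleV g h c : cocycle g h c ->
  cocycle g h^-1%g (fun x => - c ((h^-1)%g x))%R.
Proof.
move=> [cc hE]; split => [|x].
  apply: (@locally_constant2 _ _ unit _ (fun m _ => (- m)%R) _ (fun=> tt));
    last by move=> x; exact: nearW.
  by apply: locally_constant_comp => //; exact: homeo_cont.
have := hE ((h^-1)%g x); rewrite [h _]homeo_invK.
by move: ((h^-1)%g x) => y ->; rewrite zpowK.
Qed.

Lemma cocycle_generator g : cocycle g g (fun=> 1%R).
Proof. by split => [x|x]; [exact: nearW|rewrite -[1%R]add0r zpowS]. Qed.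

Lemma full_groupM g h k : topological_full_group g h -> topological_full_group g k ->
  topological_full_group g (h * k)%g.
Proof. by move=> [c hc] [d kd]; exists (fun x => c (k x) + d x)%R; exact: cocycleM. Qed.

Lemma full_groupV g h : topological_full_group g h -> topological_full_group g h^-1%g.
Proof. by move=> [c hc]; exists (fun x => - c ((h^-1)%g x))%R; exact: cocycleV. Qed.

Lemma full_group_generator g : topological_full_group g g.
Proof. by exists (fun=> 1%R); exact: cocycle_generator. Qed.

Lemma full_group1 g : topological_full_group g 1%g.
Proof. by rewrite -(mulgV g); apply: full_groupM; [|apply: full_groupV];
  exact: full_group_generator. Qed.

Lemma full_groupX g h n : topological_full_group g h -> topological_full_group g (h ^+ n)%g.
Proof.
by move=> hh; elim: n => [|n IH]; [exact: full_group1|rewrite expgS; exact: full_groupM].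
Qed.

End Minimal.

Lemma iter_homeo_continuous (X : topologicalType) (k : homeo X) i : continuous (iter i k).
Proof.
elim: i => [|i IH] x; first exact: cvg_id.
by apply: (@continuous_comp _ _ _ (iter i k) k); [exact: IH|exact: homeo_cont].
Qed.

(** * First return maps and uniqueness of the index map *)

Section FirstReturn.
Variables (X : topologicalType) (k : homeo X) (b : pred X).
Hypothesis recurrent : forall x, exists i, b (iter i.+1 k x).

(** One less than the return time, which is thereby positive by construction. *)
Definition return_index x : nat := ex_minn (recurrent x).

Definition first_return x : X := if b x then iter (return_index x).+1 k x else x.

Lemma return_indexP x i : b (iter i.+1 k x) ->
  (forall j, (j < i)%N -> ~~ b (iter j.+1 k x)) -> return_index x = i.
Proof.
move=> bi bj; rewrite /return_index; case: ex_minnP => m bm mmin.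
by apply/eqP; rewrite eqn_leq mmin //= leqNgt; apply/negP => /bj; rewrite bm.
Qed.

Lemma mem_return x : b (iter (return_index x).+1 k x).
Proof. by rewrite /return_index; case: ex_minnP. Qed.

Lemma return_index_min x j : (j < return_index x)%N -> ~~ b (iter j.+1 k x).
Proof.
by rewrite /return_index; case: ex_minnP => m bm mmin jm; apply/negP => /mmin; lia.
Qed.

Lemma mem_first_return x : b x -> b (first_return x).
Proof. by move=> bx; rewrite /first_return bx mem_return. Qed.

Lemma locally_constant_return_index : locally_constant b -> locally_constant return_index.
Proof.
move=> bc x; have Px i : \forall y \near x, b (iter i k y) = b (iter i k x).
  exact: (locally_constant_comp (@iter_homeo_continuous _ k i) bc).
apply: filterS (near_forall_lt (return_index x).+2 Px) => y Py.
apply: return_indexP => [|j jr]; first by rewrite Py // mem_return.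
by rewrite Py ?return_index_min //; lia.
Qed.

End FirstReturn.

(** The points strictly between a point of [b] and its first return lie outside [b]; read backwards,
    the same segment is a first return for [k']. *)
Lemma first_returnK (X : topologicalType) (k k' : homeo X) (b : pred X)
    (rec : forall x, exists i, b (iter i.+1 k x))
    (rec' : forall x, exists i, b (iter i.+1 k' x)) :
  cancel k k' -> cancel (first_return rec) (first_return rec').
Proof.
move=> kK x; have [bx|/negPf bx] := boolP (b x); last by rewrite /first_return bx bx.
have := mem_first_return rec bx; rewrite /first_return bx => -> .
set r := return_index _ x; rewrite (@return_indexP _ _ _ _ _ r) ?iter_cancel // => j jr.
rewrite (iter_cancel_sub _ kK); last by lia.
have -> : (r.+1 - j.+1 = (r - j.+1).+1)%N by lia.
by apply: return_index_min; rewrite -/r; lia.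
Qed.

Section ReturnCocycle.
Variables (X : topologicalType) (k : homeo X) (b : pred X).
Hypotheses (rec : forall x, exists i, b (iter i.+1 k x)) (bc : locally_constant b).

Definition return_cocycle x : int := if b x then (return_index rec x).+1%:Z%R else 0%R.

Lemma return_cocycleE x : first_return rec x = zpow k (return_cocycle x) x.
Proof. by rewrite /first_return /return_cocycle; case: ifP => // _; rewrite zpow_nat. Qed.

Lemma locally_constant_return_cocycle : locally_constant return_cocycle.
Proof.
apply: (@locally_constant2 _ _ _ _ (fun (c : bool) n => if c then n.+1%:Z%R else 0%R) b _) => //.
exact: locally_constant_return_index.
Qed.

Lemma first_return_continuous : continuous (first_return rec).
Proof. exact: cocycle_continuous locally_constant_return_cocycle return_cocycleE. Qed.

End ReturnCocycle.

Section Induced.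
Variables (X : topologicalType) (g : homeo X) (b : pred X).
Hypotheses (rec : forall x, exists i, b (iter i.+1 g x))
  (rec' : forall x, exists i, b (iter i.+1 (g^-1)%g x)) (bc : locally_constant b).

Let gV : cancel g (g^-1)%g := homeoK g.
Let gVK : cancel (g^-1)%g g := homeo_invK g.

(** The inverse is the first return map of [g^-1], hence recurrence in both directions. *)
Definition induced : homeo X :=
  Homeo (first_returnK rec rec' gV) (first_returnK rec' rec gVK)
    (first_return_continuous (rec := rec) bc) (first_return_continuous (rec := rec') bc).

Lemma full_group_induced : topological_full_group g induced.
Proof.
by exists (return_cocycle rec); split;
  [exact: locally_constant_return_cocycle | exact: return_cocycleE].
Qed.

(* On the tower [z, g z, ..., g^r z] over a point [z] of the base, [induced^-1 * g]
   climbs one floor and sends the top floor back to the base. *)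
Lemma tower_permutation_torsion (R : nat) :
  (forall x, (return_index rec x < R)%N) ->
  ((induced^-1 * g) ^+ (R`!))%g = 1%g.
Proof.
move=> rR; apply: homeoP => x; rewrite homeo_expE.
set p := (induced^-1 * g)%g.
have pE y : p y = if b (g y) then (induced^-1)%g (g y) else g y.
  by rewrite /p /= /first_return; case: (b _).
have climb z j : b z -> (j <= return_index rec z)%N -> iter j p z = iter j g z.
  move=> bz; elim: j => // j IH jr; rewrite iterS IH ?(ltnW jr) // pE.
  by rewrite (negPf (return_index_min jr)).
have cycle z : b z -> iter (return_index rec z).+1 p z = z.
  move=> bz; rewrite iterS climb // pE -iterS mem_return.
  have -> : iter (return_index rec z).+1 g z = induced z by rewrite /= /first_return bz.
  exact: homeoK.
(* Walking back from [x] to the first visit of [b] finds its tower: a return of the base point no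
   later than [x] would have stopped the walk earlier. *)
have base : exists z j, [/\ b z, (j <= return_index rec z)%N & x = iter j g z].
  have ex : exists i, b (iter i (g^-1)%g x) by have [i bi] := rec' x; exists i.+1.
  case: (ex_minnP ex) => i bi imin; exists (iter i (g^-1)%g x), i; split => //.
    rewrite leqNgt; apply/negP => ri.
    have := mem_return rec (iter i (g^-1)%g x).
    by rewrite (iter_cancel_sub _ gVK) // => /imin; lia.
  by rewrite (iter_cancel _ gVK).
have [z [j [bz jr xE]]] := base.
(* Every tower height is at most [R], so it divides R!. *)
have -> : (R`! = (R`! %/ (return_index rec z).+1) * (return_index rec z).+1)%N.
  by rewrite divnK // dvdn_fact // rR.
elim: (_ %/ _)%N => // n IH; rewrite mulSn iterD IH.
by rewrite xE -(climb _ _ bz jr) -iterD addnC iterD cycle.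
Qed.

End Induced.

(** Every forward orbit enters [b], nearby points do so at the same time, and compactness bounds
    these times. *)
Lemma uniform_recurrence (X : topologicalType) (g : homeo X) (b : pred X) :
  compact [set: X] -> minimal g -> locally_constant b -> (exists x, b x) ->
  exists R : nat, forall x, exists2 i, (i < R)%N & b (iter i g x).
Proof.
move=> /compact_near_coveringP cX gmin bc [x0 bx0].
have /(_ _)[|R _ RP] := cX nat \oo (fun R x => exists2 i, (i < R)%N & b (iter i g x)) _.
  move=> x _.
  have [n bn] : exists n, b (iter n g x).
    apply: (minimal_orbit_dense (V := [set y | b y]) x gmin); last by exists x0.
    by apply: locally_constant_set => y; apply: filterS (bc y) => z /= ->.
  exists ([set y | b (iter n g y)], [set R | (n < R)%N]) => /=.
    split; last by exists n.+1.
    have nbc := locally_constant_comp (@iter_homeo_continuous _ g n) bc.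
    by apply: filterS (nbc x) => y /= ->.
  by move=> [y R] /= [by_ nR]; exists n.
by exists R => x; apply: (RP R (leqnn R)).
Qed.

Section IndexUniqueness.
Variables (X : topologicalType) (g : homeo X) (I : homeo X -> int).
Hypothesis (Ig : is_index_map g I).
Implicit Types h k : homeo X.

Lemma index_mapM h k : topological_full_group g h -> topological_full_group g k ->
  I (h * k)%g = (I h + I k)%R.
Proof. by case: Ig => IM _ hh kk; apply: IM; exact/mem_set. Qed.

Lemma index_map1 : I 1%g = 0%R.
Proof.
have g1 := full_group1 g; have := index_mapM g1 g1.
by rewrite mulg1; lia.
Qed.

Lemma index_mapX h n : topological_full_group g h -> I (h ^+ n)%g = (I h *+ n)%R.
Proof.
move=> hh; elim: n => [|n IH]; first by rewrite index_map1.
by rewrite expgS index_mapM ?IH ?mulrS //; exact: full_groupX.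
Qed.

Lemma index_map_torsion h n : topological_full_group g h -> (0 < n)%N ->
  (h ^+ n)%g = 1%g -> I h = 0%R.
Proof.
move=> hh n0 hn; apply/eqP; have := index_mapX n hh.
by rewrite hn index_map1 => /esym/eqP; rewrite mulrn_eq0 -implyNb -lt0n n0.
Qed.

(** [k^-1 * g] is torsion, its order bounded through uniform recurrence, so [I] vanishes on it and
    [I k = I g]. *)
Lemma index_map_induced b rec rec' (bc : locally_constant b) :
  compact [set: X] -> minimal g -> I (@induced _ g b rec rec' bc) = 1%R.
Proof.
move=> cX gmin; set k := induced _ _ _.
have [[x0 _] _] := gmin.
have [|R RP] := uniform_recurrence cX gmin bc.
  by have [i bi] := rec x0; exists (iter i.+1 g x0).
have kF : topological_full_group g k by exact: full_group_induced.
have pF : topological_full_group g (k^-1 * g)%g.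
  by apply: full_groupM; [exact: full_groupV|exact: full_group_generator].
have p0 : I (k^-1 * g)%g = 0%R.
  apply: (@index_map_torsion _ R`!) => //; first exact: fact_gt0.
  apply: tower_permutation_torsion => x; have [i iR bi] := RP (g x).
  rewrite -iterSr in bi; rewrite ltnNge; apply/negP => /(leq_trans iR).
  by move/return_index_min; rewrite bi.
have := index_mapM kF pF; rewrite p0 mulgA mulgV mul1g; case: Ig => _ ->; lia.
Qed.

End IndexUniqueness.

Section IndexAgreement.
Variables (X : topologicalType) (g : homeo X).
Hypothesis (Xg : compact_minimal_system g).
Variables (I J : homeo X -> int).
Hypotheses (Ig : is_index_map g I) (Jg : is_index_map g J).
Implicit Types h k : homeo X.

Lemma cocycle_eq0 h c x : cocycle g h c -> h x = x -> c x = 0%R.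
Proof. by move=> [_ hE]; rewrite hE => hx; apply: (zpow_inj (x := x) Xg). Qed.

Lemma cocycle_trivial h c : cocycle g h c -> (forall x, c x = 0%R) -> h = 1%g.
Proof. by move=> [_ hE] c0; apply: homeoP => x; rewrite hE c0. Qed.

Lemma cocycle_support_invariant h c x : cocycle g h c -> (c (h x) == 0%R) = (c x == 0%R).
Proof.
move=> hc; apply/eqP/eqP => c0; last by rewrite [h x]hc.2 c0.
apply: (cocycle_eq0 hc); apply: (can_inj (homeoK h)).
by rewrite [LHS]hc.2 c0.
Qed.

(* If [c >= 0], composing [h] with the inverse of the first return map to the
   support of [c] lowers [c] by at least one on the support. *)
Lemma index_map_agree_nonneg m h c : cocycle g h c ->
  (forall x, (0 <= c x <= m%:Z)%R) -> I h = J h.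
Proof.
have [_ cX _ gmin] := Xg.
elim: m h c => [|m IH] h c hc cm.
  rewrite (cocycle_trivial hc); first by rewrite (index_map1 Ig) (index_map1 Jg).
  by move=> x; have := cm x; lia.
have [[x0 cx0]|c0] := pselect (exists x, (c x != 0)%R); last first.
  rewrite (cocycle_trivial hc); first by rewrite (index_map1 Ig) (index_map1 Jg).
  by move=> x; apply/eqP; apply: contrapT => /negP cx; apply: c0; exists x.
pose b x := (c x != 0)%R.
have bc : locally_constant b.
  by move=> x; apply: filterS (hc.1 x) => y; rewrite /b => ->.
have [R RP] := uniform_recurrence cX gmin bc (ex_intro _ x0 cx0).
have rec x : exists i, b (iter i.+1 g x).
  by have [i _ bi] := RP (g x); exists i; rewrite iterSr.
have rec' x : exists i, b (iter i.+1 (g^-1)%g x).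
  (* Starting [R] steps behind [x], the forward orbit meets [b] before it reaches [x]. *)
  have [i iR] := RP (iter R (g^-1)%g x).
  rewrite (iter_cancel_sub _ (homeo_invK g : cancel (g^-1)%g g)); last exact: ltnW.
  by move=> bi; exists (R - i.+1)%N; rewrite -subSn.
set k := induced rec rec' bc.
have kF : topological_full_group g k by exact: full_group_induced.
have kVc : cocycle g (k^-1)%g (fun y => - return_cocycle rec' y)%R.
  split=> [x|x]; last by rewrite -zpowN -return_cocycleE.
  by apply: filterS (locally_constant_return_cocycle rec' bc x) => y ->.
have khc := cocycleM kVc hc.
have khF : topological_full_group g (k^-1 * h)%g by eexists; exact: khc.
have E : h = (k * (k^-1 * h))%g by rewrite mulgA mulgV mul1g.
rewrite E (index_mapM Ig kF khF) (index_mapM Jg kF khF).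
rewrite (index_map_induced Ig) // (index_map_induced Jg) //; congr (_ + _)%R.
apply: (IH _ _ khc) => x; have := cm x.
rewrite /return_cocycle /b (cocycle_support_invariant _ hc).
case: eqVneq => [->|cx] /=; first by lia.
case cxE : (c x) => [[|n]|n] // cn; first by rewrite cxE in cx.
(* Going back from [h x = g^(n+1) x] meets the point [x] of the support after n + 1 steps. The first
   backward return thus takes between 1 and n + 1 steps, so the new cocycle stays nonnegative and
   drops. *)
suff : (return_index rec' (h x) <= n)%N.
  move: (return_index _ _) cn => r /=; lia.
rewrite leqNgt; apply/negP => /return_index_min/negP; apply.
by rewrite (hc.2 x) cxE zpow_nat (iter_cancel _ (homeoK g)) /b cxE.
Qed.

Lemma index_map_agree h : topological_full_group g h -> I h = J h.
Proof.
move=> [c hc]; have [_ cX _ gmin] := Xg.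
have [M cM] := locally_constant_bounded cX hc.1.
(* The bounds are separated for an induction on the lower one: composing with [g] adds 1 to the
   cocycle and to the values of [I] and [J]. *)
have {cM} [N cN] : exists N : nat, forall x, (- M%:Z <= c x <= N%:Z)%R by exists M.
elim: M N h c hc cN => [|M IH] N h c hc cN.
  by apply: (index_map_agree_nonneg hc) => x; have := cN x; rewrite oppr0; exact.
have gF := full_group_generator g.
have hF : topological_full_group g h by exists c.
have := IH N.+1 _ _ (cocycleM (cocycle_generator g) hc).
rewrite (index_mapM Ig gF hF) (index_mapM Jg gF hF).
case: Ig Jg => [_ ->] [_ ->] H; apply: (addrI 1%R); apply: H => x.
by have := cN x; lia.
Qed.

End IndexAgreement.

(** * Positive orbits and the index *)

Section OrbitModel.
Variables (X : topologicalType) (g : homeo X).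
Hypothesis Xg : compact_minimal_system g.
Implicit Types (h k : homeo X) (c d : X -> int) (x y : X) (n p q : int).
Local Open Scope ring_scope.

(* In the coordinate [n |-> g^n x] on the [g]-orbit of [x], a homeomorphism with
   cocycle [c] acts as this map. *)
Definition model c x n : int := n + c (zpow g n x).

Lemma model_spec h c x n : cocycle g h c -> h (zpow g n x) = zpow g (model c x n) x.
Proof. by move=> hc; rewrite hc.2 /model addrC zpowD. Qed.

Lemma model_iter h c x n l : cocycle g h c ->
  iter l h (zpow g n x) = zpow g (iter l (model c x) n) x.
Proof. by move=> hc; elim: l => // l IH; rewrite !iterS IH (model_spec _ _ hc). Qed.

Lemma modelK h k c d x : cocycle g h c -> cocycle g k d -> cancel h k ->
  cancel (model c x) (model d x).
Proof.
move=> hc kd hK n; apply: (zpow_inj (x := x) Xg) => /=.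
by rewrite -(model_spec _ _ kd) -(model_spec _ _ hc) hK.
Qed.

Lemma model_jumps c x (M : nat) : (forall y, - M%:Z <= c y <= M%:Z) ->
  jumps_le (model c x) M.
Proof. by move=> cM n; have := cM (zpow g n x); rewrite /model; lia. Qed.

Lemma model_mul h k c d x n : cocycle g h c -> cocycle g k d ->
  model (fun y => c (k y) + d y) x n = model c x (model d x n).
Proof.
by move=> hc kd; rewrite [RHS]/model -(model_spec _ _ kd) /model; lia.
Qed.

(** The values of [c] at the positions in [-R, R] give finitely many conditions that hold on a
    neighbourhood of [y], and the forward orbit of [x] enters it. *)
Lemma model_approx c x y (R : nat) : locally_constant c ->
  exists n, agree_on_window (model c x) (model c y) R n.
Proof.
move=> cc; have [_ _ _ gmin] := Xg.
pose P (j : nat) z := c (zpow g (j%:Z - R%:Z) z) = c (zpow g (j%:Z - R%:Z) y).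
have Py : \forall z \near y, forall j, (j < R.*2.+1)%N -> P j z.
  apply: near_forall_lt => j.
  exact: (locally_constant_comp (@homeo_cont _ (zpow g (j%:Z - R%:Z))) cc).
have [n nP] := minimal_orbit_dense x gmin (open_interior _) (ex_intro _ y Py).
exists n%:Z => i iR.
have jR : (`|(i + R%:Z)%R| < R.*2.+1)%N by lia.
have := interior_subset nP _ jR; rewrite /P.
have -> : (`|(i + R%:Z)%R|%N%:Z - R%:Z) = i by lia.
by rewrite -zpow_nat -zpowD /model => <-; lia.
Qed.

Lemma orbit_leE x n p : orbit_le g (zpow g n x) (zpow g p x) <-> n <= p.
Proof.
split=> [[k]|np].
  rewrite homeo_expE -zpow_nat -zpowD => /(zpow_inj Xg) ->; lia.
exists `|(p - n)%R|%N; rewrite homeo_expE -zpow_nat -zpowD; congr (zpow g _ x); lia.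
Qed.

Lemma orbit_ltE x n p : orbit_lt g (zpow g n x) (zpow g p x) <-> n < p.
Proof.
rewrite /orbit_lt orbit_leE; split=> [[np ne]|np].
  by rewrite lt_neqAle np andbT; apply/eqP => E; apply: ne; rewrite E.
by split; [exact: ltW|move/(zpow_inj Xg) => E; move: np; rewrite E ltxx].
Qed.

Lemma forward_orbitE x n : forward_orbit g x (zpow g n x) <-> 0 <= n.
Proof. exact: (orbit_leE x 0 n). Qed.

Definition window (M : nat) : seq int := [seq l%:Z - M%:Z | l <- iota 0 M.*2.+1].

Lemma mem_window M i : (i \in window M) = (- M%:Z <= i <= M%:Z).
Proof.
apply/mapP/idP => [[l + ->]|iM]; first by rewrite mem_iota; lia.
by exists `|(i + M%:Z)%R|%N; [rewrite mem_iota|]; lia.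
Qed.

Lemma uniq_window M : uniq (window M).
Proof. by rewrite map_inj_uniq ?iota_uniq // => i j /addIr[]. Qed.

Lemma crossing_window f (M : nat) i :
  jumps_le f M -> crossing f i != 0 -> i \in window M.
Proof.
move=> fM; have := fM i; rewrite mem_window /crossing.
by case: (leP 0 (f i)); case: (leP 0 i) => //; lia.
Qed.

Lemma net_flowE f s : net_flow f s =
  (count (fun i => (0 <= f i)%R && ~~ (0 <= i)%R) s)%:Z -
  (count (fun i => (0 <= i)%R && ~~ (0 <= f i)%R) s)%:Z.
Proof.
elim: s => [|i s IH]; first by rewrite /net_flow big_nil.
rewrite /net_flow big_cons -/(net_flow f s) IH /crossing /=.
by case: (0 <= f i); case: (0 <= i); rewrite /=; lia.
Qed.

Lemma card_fset_set_seq (T : choiceType) (A : set T) (s : seq T) : uniq s ->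
  (forall i, A i <-> i \in s) -> #|` fset_set A| = size s.
Proof.
move=> us As; have -> : A = [set` [fset i in s]%fset].
  by apply/seteqP; split => i /=; rewrite inE As.
by rewrite set_fsetK card_fseq undup_id.
Qed.

(** In coordinates the two set differences are the starting points of the upward and of the downward
    arrows across 0. *)
Lemma index_at_net_flow h c x s : cocycle g h c -> uniq s ->
  (forall i, crossing (model c x) i != 0 -> i \in s) ->
  index_at g x h = net_flow (model c x) s.
Proof.
move=> hc us sP; set f := model c x in sP *; rewrite net_flowE /index_at.
have memV y : (h^-1%g @` forward_orbit g x) y <-> forward_orbit g x (h y).
  split=> [[z zx <-]|hyx]; first by rewrite [h _]homeo_invK.
  by exists (h y) => //; exact: homeoK.
have ei := zpow_inj (x := x) Xg.
have memE n : forward_orbit g x (h (zpow g n x)) <-> 0 <= f n.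
  by rewrite (model_spec _ _ hc) forward_orbitE.
have fwdP y : forward_orbit g x y -> exists n, y = zpow g n x.
  by case=> n ->; exists n%:Z.
have hfwdP y : forward_orbit g x (h y) -> exists n, y = zpow g n x.
  case/fwdP => n hy; exists (model (fun z => - c ((h^-1)%g z)) x n).
  by rewrite -(model_spec _ _ (cocycleV hc)) -hy [_ (h y)]homeoK.
congr (_%:Z - _%:Z); rewrite -size_filter -(size_map (fun n => zpow g n x));
  (apply: card_fset_set_seq; first by rewrite map_inj_uniq // filter_uniq);
  move=> y; split=> [[yA yB]|/mapP[n nP ->]].
- move: (yA) yB => /memV/hfwdP[n yE]; move/memV: yA.
  rewrite yE memE forward_orbitE => fn /negP n0.
  apply/mapP; exists n => //; rewrite mem_filter fn n0; apply: sP.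
  by rewrite /crossing fn (negPf n0).
- move: nP; rewrite mem_filter => /andP[/andP[fn n0] _].
  by split; [apply/memV/memE|rewrite forward_orbitE; exact/negP].
- move: (yA) yB => /fwdP[n yE]; rewrite memV; move: yA.
  rewrite yE memE forward_orbitE => n0 /negP fn.
  apply/mapP; exists n => //; rewrite mem_filter fn n0; apply: sP.
  by rewrite /crossing n0 (negPf fn).
- move: nP; rewrite mem_filter => /andP[/andP[n0 fn] _].
  by split; [rewrite forward_orbitE|rewrite memV memE; exact/negP].
Qed.

End OrbitModel.

Section PositiveOrbits.
(** [k] is tied to [h^-1] by an equation only, so that the section also applies with [h] and its
    inverse exchanged. *)
Variables (X : topologicalType) (g h k : homeo X) (c d : X -> int) (M : nat).
Hypotheses (Xg : compact_minimal_system g)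
  (hc : cocycle g h c) (kd : cocycle g k d) (kE : k = (h^-1)%g)
  (cM : forall x, (- M%:Z <= c x <= M%:Z)%R).
Implicit Types (x y : X) (n p q : int).
Local Open Scope ring_scope.

Let f x := model g c x.
Let f' x := model g d x.

Let hK : cancel h k. Proof. by rewrite kE; exact: homeoK. Qed.
Let kK : cancel k h. Proof. by rewrite kE; exact: homeo_invK. Qed.
Let fK x : cancel (f x) (f' x). Proof. exact: modelK hc kd hK. Qed.
Let f'K x : cancel (f' x) (f x). Proof. exact: modelK kd hc kK. Qed.
Let fM x : jumps_le (f x) M. Proof. exact: model_jumps. Qed.

Lemma homeo_orbitE x p y :
  Defs.orbit h (zpow g p x) y <-> exists2 q, same_orbit (f x) p q & y = zpow g q x.
Proof.
split=> [[t _ <-]|[q [l [->|pE]] ->]].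
- case: t => l.
    rewrite zpow_nat (model_iter _ _ _ hc).
    by exists (iter l (f x) p) => //; exists l; left.
  rewrite /zpow homeo_expVE -kE (model_iter _ _ _ kd).
  by exists (iter l.+1 (f' x) p) => //; exists l.+1; right; rewrite (iter_cancel _ (f'K x)).
- by exists l%:Z => //; rewrite zpow_nat (model_iter _ _ _ hc).
- exists (- l%:Z) => //; rewrite pE -(model_iter _ _ _ hc).
  by rewrite -zpow_nat zpowK.
Qed.

Lemma homeo_orbit_eq x p q :
  Defs.orbit h (zpow g p x) = Defs.orbit h (zpow g q x) <-> same_orbit (f x) p q.
Proof.
have fi : injective (f x) := can_inj (fK x).
split=> [E|pq].
  have : Defs.orbit h (zpow g p x) (zpow g q x).
    by rewrite E homeo_orbitE; exists q => //; exact: same_orbit_refl.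
  by case/homeo_orbitE => r pr /(zpow_inj Xg) ->.
have sub a b : same_orbit (f x) a b -> Defs.orbit h (zpow g a x) `<=` Defs.orbit h (zpow g b x).
  move=> ab y /homeo_orbitE[r ar ->]; apply/homeo_orbitE; exists r => //.
  exact: same_orbit_trans fi (same_orbit_sym ab) ar.
by apply/seteqP; split; apply: sub => //; exact: same_orbit_sym.
Qed.

(** Positivity for the single pair y = z = g^p x already keeps the two ends on either side of [p].
    This excludes periodicity, and injectivity drives the ends to infinity. *)
Lemma positive_orbitE x p :
  positive_orbit g h (Defs.orbit h (zpow g p x)) <-> ascending (f x) (f' x) p.
Proof.
have fi : injective (f x) := can_inj (fK x).
have hX l q : (h ^+ l)%g (zpow g q x) = zpow g (iter l (f x) q) x.
  by rewrite homeo_expE (model_iter _ _ _ hc).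
have hV l q : (h ^- l)%g (zpow g q x) = zpow g (iter l (f' x) q) x.
  by rewrite homeo_expVE -kE (model_iter _ _ _ kd).
have self : Defs.orbit h (zpow g p x) (zpow g p x).
  by apply/homeo_orbitE; exists p => //; exact: same_orbit_refl.
split=> [[_ /(_ _ _ self self)[n nP]]|ap].
  have {}nP l : (n <= l)%N -> p < iter l (f x) p /\ iter l (f' x) p < p.
    by move=> /nP; rewrite hX hV !(orbit_ltE Xg).
  have ap l : iter l.+1 (f x) p != p.
    apply/eqP => per; have [] := nP (n * l.+1)%N; first by rewrite leq_pmulr.
    by rewrite iter_periodic // ltxx.
  have ui := aperiodic_iter_inj fi ap.
  have vi := aperiodic_iter_inj (can_inj (f'K x)) (fun l => aperiodic_inverse (f'K x) (ap l)).
  split=> z.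
    have [||K KP] := @injective_bounded_below (fun l => iter (l + n) (f x) p) p _ _ z.
    - by move=> i j /ui /addIn.
    - by move=> l; apply: ltW; case: (nP (l + n)%N (leq_addl _ _)).
    by exists (K + n)%N => l lK; have := KP (l - n)%N; rewrite subnK; [apply|]; lia.
  have [||K KP] := @injective_bounded_above (fun l => iter (l + n) (f' x) p) p _ _ z.
  - by move=> i j /vi /addIn.
  - by move=> l; apply: ltW; case: (nP (l + n)%N (leq_addl _ _)).
  by exists (K + n)%N => l lK; have := KP (l - n)%N; rewrite subnK; [apply|]; lia.
split; first by exists (zpow g p x).
move=> _ _ /homeo_orbitE[q pq ->] /homeo_orbitE[r pr ->].
have [up dn] := ascending_same_orbit (fK x) (f'K x) pq ap.
have [K KP] := up r; have [L LP] := dn r.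
exists (maxn K L) => l; rewrite geq_max => /andP[/KP Kl /LP Ll].
by rewrite hX hV !(orbit_ltE Xg).
Qed.

(* Every positive orbit meets the window [-M, M], since its jumps are at most [M]. *)
Lemma card_positive_orbits x (r : seq int) : uniq r ->
  (forall i, i \in window M ->
     exists2 j, j \in r & same_orbit (f x) j i) ->
  (forall i j, i \in r -> j \in r -> same_orbit (f x) i j -> i = j) ->
  [set W | positive_orbit g h W /\ W `<=` Defs.orbit g x]
    #= `I_(count (fun j => `[< ascending (f x) (f' x) j >]) r).
Proof.
move=> ur rP rI; rewrite -size_filter; set s := seq.filter _ r.
have us : uniq s by rewrite filter_uniq.
have fi : injective (f x) := can_inj (fK x).
have -> : [set W | positive_orbit g h W /\ W `<=` Defs.orbit g x] =
    (fun j => Defs.orbit h (zpow g j x)) @` [set` s].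
  apply/seteqP; split=> [W [Wpos Wx]|_ [j js <-]] /=.
    have [[w WE] _] := Wpos.
    have Ww : W w by rewrite WE; exists 0.
    have [p _ wE] := Wx _ Ww; rewrite -wE in WE.
    have ap : ascending (f x) (f' x) p by rewrite -positive_orbitE -WE.
    have [q [pq qM _]] := ascending_crosses 0 0 (fK x) (f'K x) (fM x) ap.
    have [|j jr jq] := rP q.
      by rewrite mem_window; lia.
    have jp : same_orbit (f x) p j := same_orbit_trans fi pq (same_orbit_sym jq).
    exists j; last by rewrite WE; apply/homeo_orbit_eq; exact: same_orbit_sym.
    rewrite /= mem_filter jr andbT; apply/asboolP.
    exact: ascending_same_orbit (fK x) (f'K x) jp ap.
  move: js; rewrite /= mem_filter => /andP[/asboolP aj _].
  split; first exact/positive_orbitE.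
  by move=> _ /homeo_orbitE[q _ ->]; exists q.
apply: card_eq_trans (inj_card_eq _) _.
move=> i j /set_mem; rewrite /= mem_filter => /andP[_ ir].
  move=> /set_mem; rewrite /= mem_filter => /andP[_ jr].
  by move=> /homeo_orbit_eq; exact: rI.
have -> : [set` s] = [set` [fset i in s]%fset] by apply/seteqP; split => i /=; rewrite inE.
by apply/card_eq_fsetP; rewrite card_fseq undup_id.
Qed.

End PositiveOrbits.

(** * Comparison of two [g]-orbits, inverses, and additivity of the index *)

(** By recurrence the ascending representatives of [f] yield as many distinct ascending orbits of
    [e]; each meets the window, so distinct entries of [s] represent them. *)
Lemma card_ascending_le (f f' e e' : int -> int) (M : nat) (r s : seq int) :
  cancel f f' -> cancel f' f -> cancel e e' -> cancel e' e ->
  jumps_le f M -> jumps_le e M ->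
  (forall R : nat, exists n, agree_on_window f e R n) ->
  uniq r -> (forall i j, i \in r -> j \in r -> same_orbit f i j -> i = j) ->
  (forall i, i \in window M ->
     exists2 j, j \in s & same_orbit e j i) ->
  (count (fun j => `[< ascending f f' j >]) r <=
   count (fun j => `[< ascending e e' j >]) s)%N.
Proof.
move=> fK f'K eK e'K fM eM fe ur rI sP; rewrite -!size_filter.
set u := seq.filter _ r; set v := seq.filter _ s.
have uu : uniq u by rewrite filter_uniq.
pose p (a : 'I_(size u)) := nth 0%R u a.
have pu a : p a \in u by exact: mem_nth.
have [||q [qa qI]] := @ascending_family_approx f f' e e' M _ p fK f'K eK e'K fM eM fe.
- by move=> a; have := pu a; rewrite mem_filter => /andP[/asboolP].
- move=> a b ab pab.
  have pr t : p t \in r by have := pu t; rewrite mem_filter => /andP[].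
  have /eqP := rI _ _ (pr a) (pr b) pab; rewrite nth_uniq // => /eqP/val_inj abE.
  by rewrite abE eqxx in ab.
have /choice[j jP] : forall a, exists j, j \in v /\ same_orbit e j (q a).
  move=> a; have [t [qt tM _]] := ascending_crosses 0 0 eK e'K eM (qa a).
  have [|j js jt] := sP t.
    by rewrite mem_window; lia.
  have jq : same_orbit e j (q a) := same_orbit_trans (can_inj eK) jt (same_orbit_sym qt).
  exists j; split => //; rewrite mem_filter js andbT; apply/asboolP.
  exact: ascending_same_orbit eK e'K (same_orbit_sym jq) (qa a).
rewrite -[X in (X <= _)%N]card_ord cardE -(size_map j); apply: uniq_leq_size.
  rewrite map_inj_uniq ?enum_uniq // => a b jab.
  apply/eqP; apply: contrapT => /negP ab; apply: (qI a b ab).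
  have [_ ja] := jP a; have [_ jb] := jP b.
  by apply: (same_orbit_trans (can_inj eK) (same_orbit_sym ja)); rewrite jab.
by move=> _ /mapP[a _ ->]; case: (jP a).
Qed.

Lemma orbit_inverse (X : topologicalType) (h : homeo X) x :
  Defs.orbit (h^-1)%g x = Defs.orbit h x.
Proof.
apply/seteqP; split => y [t _ <-]; exists (- t)%R => //; first by rewrite zpowN.
by rewrite zpowN opprK.
Qed.

(** Passing to [g^-1] reverses the order, which amounts to exchanging the forward and backward
    conditions on [h]. Results on positive orbits then count the negative ones. *)
Lemma negative_orbitE (X : topologicalType) (g h : homeo X) W :
  negative_orbit g h W <-> positive_orbit g (h^-1)%g W.
Proof.
have leV y z : orbit_le (g^-1)%g y z <-> orbit_le g z y.
  split=> -[n ->]; exists n; rewrite !homeo_expE.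
    by rewrite (iter_cancel _ (homeo_invK g : cancel (g^-1)%g g)).
  by rewrite (iter_cancel _ (homeoK g)).
have ltV y z : orbit_lt (g^-1)%g y z <-> orbit_lt g z y.
  by rewrite /orbit_lt leV; split => -[? E]; split => // /esym.
have oV : is_orbit h W <-> is_orbit (h^-1)%g W.
  by split=> -[x ->]; exists x; rewrite orbit_inverse.
have XV n : ((h^-1) ^- n = h ^+ n)%g by rewrite expVgn invgK.
rewrite /negative_orbit /positive_orbit oV.
split=> -[oW WP]; split => // y z yW zW; have [n nP] := WP y z yW zW;
  by exists n => l /nP; rewrite !ltV expVgn invgK => -[].
Qed.

(** The crossing of a composition at [i] is that of [e] at [i] plus that of [f] at [e i]; as [e] is
    a bijection, the second sum is the flow of [f] reindexed. *)
Lemma index_at_index_map (X : topologicalType) (g : homeo X) x :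
  compact_minimal_system g -> is_index_map g (index_at g x).
Proof.
move=> Xg; have [_ cX _ _] := Xg; split; last first.
  (* The only arrow of [g] across 0 starts at -1. *)
  rewrite (@index_at_net_flow _ _ Xg _ _ x [:: -1]%R (cocycle_generator g)) //.
    by rewrite /net_flow big_seq1.
  move=> i; rewrite /crossing /model inE.
  by case: (lerP 0 i) => i0; case: (lerP 0 (i + 1))%R => //= i1 _; apply/eqP; lia.
move=> h k /set_mem[c hc] /set_mem[d kd].
have [M cM] := locally_constant_bounded cX hc.1.
have [N dN] := locally_constant_bounded cX kd.1.
set f := model g c x; set e := model g d x; set e' := model g (fun y => - d ((k^-1)%g y))%R x.
have fM : jumps_le f M by exact: model_jumps.
have eN : jumps_le e N by exact: model_jumps.
have eK : cancel e e' by exact: (modelK Xg x kd (cocycleV kd) (homeoK k)).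
have e'K : cancel e' e by exact: (modelK Xg x (cocycleV kd) kd (homeo_invK k)).
have e'N := jumps_le_inverse e'K eN.
(* With radius M + N, the image of the window under [e] still contains [-M, M], where [crossing f]
   is supported. *)
set w := window (M + N).
have uw : uniq w := uniq_window _.
have feE i : model g (fun y => c (k y) + d y)%R x i = f (e i) by exact: (model_mul x i hc kd).
rewrite (index_at_net_flow (s := w) Xg (cocycleM hc kd)) //; last first.
  by move=> i; apply: crossing_window => j; rewrite feE; have := eN j; have := fM (e j); lia.
have fs i : crossing f i != 0%R -> i \in w.
  by apply: crossing_window => j; have := fM j; lia.
rewrite (index_at_net_flow (s := w) Xg hc) // (index_at_net_flow (s := w) Xg kd) //; last first.
  by move=> i; apply: crossing_window => j; have := eN j; rewrite -/e; lia.
rewrite /net_flow; transitivity (\sum_(i <- w) (crossing f (e i) + crossing e i))%R.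
  by apply: eq_bigr => i _; rewrite /crossing feE addrA subrK.
rewrite big_split /=; congr (_ + _)%R.
rewrite -(big_map e xpredT (crossing f)); apply: eq_sum_support => //.
  by rewrite map_inj_uniq //; exact: can_inj eK.
move=> i ci; rewrite (fs _ ci) -(e'K i) mem_map; last exact: can_inj eK.
have := crossing_window fM ci; have := e'N i; rewrite !mem_window; lia.
Qed.


Theorem theorem1p7 (X : topologicalType) (g h : homeo X)
    (Xg : compact_minimal_system g) (hg : topological_full_group g h) :
  exists op om : nat,
    (forall O : set X, is_orbit g O ->
       [set W | positive_orbit g h W /\ W `<=` O] #= `I_op /\
       [set W | negative_orbit g h W /\ W `<=` O] #= `I_om) /\
    (forall I : homeo X -> int, is_index_map g I ->
       I h = (op%:Z - om%:Z)%R) /\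
    (forall x : X, index_at g x h = (op%:Z - om%:Z)%R).
Proof.
have [_ cX _ [[x0 _] _]] := Xg.
have [c hc] := hg; have [M cM] := locally_constant_bounded cX hc.1.
pose d y := (- c ((h^-1)%g y))%R; have kd : cocycle g (h^-1)%g d := cocycleV hc.
have dM y : (- M%:Z <= d y <= M%:Z)%R by rewrite /d; have := cM ((h^-1)%g y); lia.
pose f x := model g c x; pose f' x := model g d x.
have fK x : cancel (f x) (f' x) by exact: (modelK Xg x hc kd (homeoK h)).
have f'K x : cancel (f' x) (f x) by exact: (modelK Xg x kd hc (homeo_invK h)).
have fM x : jumps_le (f x) M by exact: model_jumps.
have f'M x : jumps_le (f' x) M by exact: model_jumps.
pose w := window M.
(* One list [r x] serves both counts, as [f x] and its inverse have the same orbits. *)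
have /choice[r rP] x : exists r, [/\ uniq r,
    forall i, i \in w -> exists2 j, j \in r & same_orbit (f x) j i &
    forall i j, i \in r -> j \in r -> same_orbit (f x) i j -> i = j].
  have [|||r [ur _ wr rI]] := @class_representatives _ (same_orbit (f x)) w.
  - exact: same_orbit_refl.
  - by move=> i j; exact: same_orbit_sym.
  - by move=> i j l; exact: same_orbit_trans (can_inj (fK x)).
  by exists r.
have ur x : uniq (r x) by case: (rP x).
have wr x i : i \in w -> exists2 j, j \in r x & same_orbit (f x) j i.
  by case: (rP x) => _ + _; apply.
have rI x i j : i \in r x -> j \in r x -> same_orbit (f x) i j -> i = j.
  by case: (rP x) => _ _; apply.
have inv x p q : same_orbit (f x) p q <-> same_orbit (f' x) p q.
  by split; apply: same_orbit_inverse.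
have wr' x i : i \in w -> exists2 j, j \in r x & same_orbit (f' x) j i.
  by move=> /(wr x)[j jr ji]; exists j => //; exact/inv.
have rI' x i j : i \in r x -> j \in r x -> same_orbit (f' x) i j -> i = j.
  by move=> ir jr /inv; exact: rI.
pose op x := count (fun j => `[< ascending (f x) (f' x) j >]) (r x).
pose om x := count (fun j => `[< ascending (f' x) (f x) j >]) (r x).
(* Any two [g]-orbits approximate each other, so the inequality holds both ways and the count is
   constant. *)
have op_le x y : (op x <= op y)%N.
  apply: (card_ascending_le (fK x) (f'K x) (fK y) (f'K y) (fM x) (fM y) _ (ur x) _ (wr y)).
    by move=> R; apply: model_approx => //; exact: hc.1.
  exact: rI.
have om_le x y : (om x <= om y)%N.
  apply: (card_ascending_le (f'K x) (fK x) (f'K y) (fK y) (f'M x) (f'M y) _ (ur x) _ (wr' y)).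
    by move=> R; apply: model_approx => //; exact: kd.1.
  exact: rI'.
have opE x : op x = op x0 by apply/eqP; rewrite eqn_leq !op_le.
have omE x : om x = om x0 by apply/eqP; rewrite eqn_leq !om_le.
have indexE x : index_at g x h = ((op x0)%:Z - (om x0)%:Z)%R.
  have sP i : crossing (f x) i != 0%R -> i \in w by exact: crossing_window.
  rewrite (index_at_net_flow Xg hc (uniq_window M) sP) -(opE x) -(omE x).
  exact: (net_flow_representatives (fK x) (f'K x) (fM x) (uniq_window M) sP (ur x) (wr x) (rI x)).
exists (op x0), (om x0); split; last first.
  (* [index_at g x0] is itself an index map, and any two index maps agree on the full group. *)
  split=> // I II; rewrite -(indexE x0).
  exact: (index_map_agree Xg II (index_at_index_map x0 Xg)).
move=> _ [x ->]; split.
  rewrite -(opE x); exact: (card_positive_orbits Xg hc kd erefl cM (ur x) (wr x) (rI x)).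
have -> : [set W | negative_orbit g h W /\ W `<=` Defs.orbit g x] =
    [set W | positive_orbit g (h^-1)%g W /\ W `<=` Defs.orbit g x].
  by apply/seteqP; split => W [/negative_orbitE].
rewrite -(omE x).
exact: (card_positive_orbits Xg kd hc (esym (invgK h)) dM (ur x) (wr' x) (rI' x)).
Qed.
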